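(* Let $\mathbb{K}$ be any field of characteristic $0$, let $n\ge 1$ and let $R=\mathbb{K}[x_1,\ldots,x_n]$. (1) Let $L$ be an arbitrary nilpotent Lie algebra over $\mathbb{K}$ of dimension $n$. Then there exists a basic subalgebra $\overline{L}$ of $W_n(\mathbb{K})$ such that $\overline{L}$ is isomorphic to $L$. (2) Let $L$ be a nilpotent Lie algebra of dimension $n$ over $\mathbb{K}$ with a basis $\{l_1,\ldots,l_n\}$ whose structure constants $c_{ij}^k\in\mathbb{K}$, defined by $[l_i,l_j]=\sum_{k=1}^n c_{ij}^k l_k$, satisfy $c_{ij}^k=0$ whenever $k\leq \max(i,j)$. Let $\overline{L}$ be a basic subalgebra of $W_n(\mathbb{K})$ isomorphic to $L$, and let $D_i\in\overline{L}$ be the image of $l_i$ under an isomorphism $L\to\overline{L}$, $i=1,\ldots,n$. Write $\frac{\partial}{\partial x_i}=\sum_{j=1}^n b_{ij}D_j$ with $b_{ij}\in R$, and put $\overline{b_p}=\sum_{i=1}^n b_{pi}\otimes l_i\in R\otimes_{\mathbb{K}}L$ for $p=1,\ldots,n$. Then there exists an element $\overline{w}=\sum_{i=1}^n w_i\otimes l_i\in R\otimes_{\mathbb{K}}L$ such that $\det J(w_1,\ldots,w_n)\in\mathbb{K}^{*}$ and $$\overline{b_p}=\sum_{i=1}^{\infty}\frac{1}{i!}\left(\operatorname{ad}\overline{w}\right)^{i-1}\left(-\frac{\partial\overline{w}}{\partial x_p}\right),\qquad p=1,\ldots,n$$ (the number of nonzero summands in this series is finite because the Lie algebra $R\otimes_{\mathbb{K}}L$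 is nilpotent).
   Context: $W_n(\mathbb{K})$ denotes the Lie algebra over $\mathbb{K}$ (under the commutator bracket) of all $\mathbb{K}$-derivations of $R=\mathbb{K}[x_1,\ldots,x_n]$; it is also a free $R$-module of rank $n$ with basis $\frac{\partial}{\partial x_1},\ldots,\frac{\partial}{\partial x_n}$. A Lie subalgebra $L'$ of $W_n(\mathbb{K})$ of dimension $n$ over $\mathbb{K}$ is called basic if every basis of $L'$ over $\mathbb{K}$ is a basis of the $R$-module $W_n(\mathbb{K})$. For an $n$-dimensional Lie algebra $L$ with basis $\{l_1,\ldots,l_n\}$, the tensor product $R\otimes_{\mathbb{K}}L$ is the Lie algebra with bracket $[f\otimes l,\,g\otimes l']=fg\otimes[l,l']$; it is a free $R$-module with basis $1\otimes l_1,\ldots,1\otimes l_n$. For $\overline{w}=\sum_i w_i\otimes l_i$ one sets $\frac{\partial\overline{w}}{\partial x_p}=\sum_i\frac{\partial w_i}{\partial x_p}\otimes l_i$, and $(\operatorname{ad}\overline{w})(\overline{u})=[\overline{w},\overline{u}]$, with $(\operatorname{ad}\overline{w})^0$ the identity. $J(w_1,\ldots,w_n)$ is the Jacobian matrix $\left(\frac{\partial w_i}{\partial x_j}\right)_{i,j=1}^n$, and $\mathbb{K}^{*}=\mathbb{K}\setminus\{0\}$. *)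

(* Defs.v *)
From HB Require Import structures.
From mathcomp Require Import all_boot all_order all_algebra.
From mathcomp Require Import ring.
From mathcomp Require Import boolp classical_sets functions.
From mathcomp Require Import mpoly.

Set Implicit Arguments.
Unset Strict Implicit.
Unset Printing Implicit Defensive.

Import GRing.Theory.
Local Open Scope ring_scope.

HB.mixin Record Lmodule_isLie (K : fieldType) V of GRing.Lmodule K V := {
  lie : V -> V -> V;
  lie_linearl : forall y, linear (lie^~ y);
  lie_linearr : forall x, linear (lie x);
  liexx : forall x, lie x x = 0;
  lie_jacobi : forall x y z,
    lie x (lie y z) + lie y (lie z x) + lie z (lie x y) = 0
}.

#[short(type="lieAlgType")]
HB.structure Definition LieAlgebra (K : fieldType) :=
  {V of Lmodule_isLie K V & GRing.Lmodule K V}.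

#[short(type="lieVectType")]
HB.structure Definition LieVector (K : fieldType) :=
  {V of LieAlgebra K V & Vector K V}.

Section LieTheory.
Variables (K : fieldType) (V : lieAlgType K).
Implicit Types (x y z : V).

Lemma lieDl x y z : lie (x + y) z = lie x z + lie y z.
Proof. by rewrite -[x]scale1r (lie_linearl z) !scale1r. Qed.
Lemma lieDr x y z : lie x (y + z) = lie x y + lie x z.
Proof. by rewrite -[y]scale1r (lie_linearr x) !scale1r. Qed.
Lemma lie0l y : lie 0 y = 0 :> V.
Proof. by apply: (addrI (lie 0 y)); rewrite -lieDl !addr0. Qed.
Lemma lie0r x : lie x 0 = 0 :> V.
Proof. by apply: (addrI (lie x 0)); rewrite -lieDr !addr0. Qed.
Lemma lieZl (a : K) x y : lie (a *: x) y = a *: lie x y.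
Proof. by have /= := lie_linearl y a x 0; rewrite lie0l !addr0. Qed.
Lemma lieZr (a : K) x y : lie x (a *: y) = a *: lie x y.
Proof. by have /= := lie_linearr x a y 0; rewrite lie0r !addr0. Qed.
Lemma lie_anti x y : lie x y + lie y x = 0.
Proof.
by have := liexx (x + y); rewrite lieDl !lieDr !liexx add0r addr0.
Qed.

Definition lie_span (A B : set V) : set V := fun v =>
  exists (m : nat) (c : 'I_m -> K) (a b : 'I_m -> V),
    [/\ forall i, A (a i), forall i, B (b i) &
        v = \sum_i c i *: lie (a i) (b i)].

Fixpoint lower_central (k : nat) : set V :=
  if k is k'.+1 then lie_span setT (lower_central k') else setT.

Definition lie_nilpotent : Prop :=
  exists k, forall v, lower_central k v -> v = 0.

Definition lie_subalgebra (S : set V) : Prop :=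
  [/\ S 0, forall (a : K) x y, S x -> S y -> S (a *: x + y) &
      forall x y, S x -> S y -> S (lie x y)].

End LieTheory.

Arguments lie_nilpotent {K} V.

Definition is_basis (A : nzRingType) (M : lmodType A) (S : set M) (m : nat)
    (e : 'I_m -> M) : Prop :=
  [/\ forall i, S (e i),
      forall v, S v -> exists c : 'I_m -> A, v = \sum_i c i *: e i &
      forall c : 'I_m -> A, \sum_i c i *: e i = 0 -> forall i, c i = 0].

Definition lie_iso_onto (K : fieldType) (L V : lieAlgType K)
    (phi : {linear L -> V}) (S : set V) : Prop :=
  [/\ injective phi, range phi = S &
      forall x y, phi (lie x y) = lie (phi x) (phi y)].

Section Derivations.
Variables (K : fieldType) (A : comAlgType K).

Definition is_derivation (D : A -> A) : Prop :=
  linear D /\ forall f g, D (f * g) = D f * g + f * D g.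

Definition derivation_pred : {pred (A -> A)} :=
  fun D => `[< is_derivation D >].

(* The functional choice axioms of boolp give A -> A, hence this subtype, its
   choice structure. *)
Record derivation := Derivation {
  der_fun :> A -> A;
  der_funP : der_fun \in derivation_pred
}.

HB.instance Definition _ := [isSub for der_fun].
HB.instance Definition _ := [Choice of derivation by <:].

Lemma derivation_submod : submod_closed derivation_pred.
Proof.
split=> [|a D E /asboolP[linD leibD] /asboolP[linE leibE]]; apply/asboolP.
  split=> [a f g|f g]; first by rewrite /= scaler0 addr0.
  by rewrite /= mul0r mulr0 addr0.
have addE (f : A) : (a *: D + E) f = a *: D f + E f by [].
split=> [b f g|f g]; rewrite !addE.
  rewrite linD linE !scalerDr !scalerA [a * b]mulrC -!addrA; congr (_ + _).
  by rewrite addrCA.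
rewrite leibD leibE scalerDr mulrDl mulrDr -scalerAl -scalerAr.
by rewrite -!addrA; congr (_ + _); rewrite addrCA.
Qed.

HB.instance Definition _ :=
  GRing.isSubmodClosed.Build K (A -> A) derivation_pred derivation_submod.
HB.instance Definition _ := [SubChoice_isSubLmodule of derivation by <:].

Implicit Types (D E : derivation) (f g : A).

Lemma derivation_linear D : linear D.
Proof. by have /asboolP[] := der_funP D. Qed.
HB.instance Definition _ D :=
  GRing.isLinear.Build K A A *:%R (der_fun D) (derivation_linear D).

Lemma derivationM D f g : D (f * g) = D f * g + f * D g.
Proof. by have /asboolP[] := der_funP D. Qed.

Lemma derivationB D f g : D (f - g) = D f - D g.
Proof. exact: linearB. Qed.

Lemma derivationP D E : D =1 E -> D = E.
Proof. by move=> DE; apply: val_inj; apply/funext. Qed.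

Lemma derivation_addE D E f : (D + E) f = D f + E f.
Proof. by []. Qed.
Lemma derivation_oppE D f : (- D) f = - D f.
Proof. by []. Qed.
Lemma derivation_scaleE (a : K) D f : (a *: D) f = a *: D f.
Proof. by []. Qed.
Lemma derivation_0E f : (0 : derivation) f = 0.
Proof. by []. Qed.

Lemma derivation_commutator_subproof D E :
  (fun f => D (E f) - E (D f)) \in derivation_pred.
Proof.
apply/asboolP; split=> [a f g|f g].
  by rewrite !derivation_linear scalerBr opprD addrACA.
rewrite !derivationM !linearD /= !derivationM; ring.
Qed.

Definition derivation_commutator D E :=
  Derivation (derivation_commutator_subproof D E).

Lemma derivation_commutatorE D E f :
  derivation_commutator D E f = D (E f) - E (D f).
Proof. by []. Qed.

Lemma der_lieDl E : linear (derivation_commutator^~ E).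
Proof.
move=> a D D'; apply: derivationP => f.
rewrite derivation_commutatorE !(derivation_addE, derivation_scaleE).
by rewrite derivation_linear !derivation_commutatorE scalerBr opprD addrACA.
Qed.
Lemma der_lieDr D : linear (derivation_commutator D).
Proof.
move=> a E E'; apply: derivationP => f.
rewrite derivation_commutatorE !(derivation_addE, derivation_scaleE).
by rewrite derivation_linear !derivation_commutatorE scalerBr opprD addrACA.
Qed.
Lemma der_liexx D : derivation_commutator D D = 0.
Proof. by apply: derivationP => f; rewrite derivation_0E /= subrr. Qed.
Lemma der_jacobi (D E F : derivation) :
  derivation_commutator D (derivation_commutator E F)
  + derivation_commutator E (derivation_commutator F D)
  + derivation_commutator F (derivation_commutator D E) = 0.
Proof.
apply: derivationP => f; rewrite !derivation_addE derivation_0E.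
rewrite !derivation_commutatorE !derivationB; ring.
Qed.

HB.instance Definition _ := Lmodule_isLie.Build K derivation
  der_lieDl der_lieDr der_liexx der_jacobi.

Lemma der_scale_subproof f D : (fun g => f * D g) \in derivation_pred.
Proof.
apply/asboolP; split=> [a g h|g h].
  by rewrite derivation_linear mulrDr -scalerAr.
rewrite derivationM; ring.
Qed.

Definition der_scale f D : derivation := Derivation (der_scale_subproof f D).

End Derivations.

(* The derivations again, as a module over the algebra A itself: a synonym is
   needed because [derivation A] already carries its K-module structure. *)
Definition derivation_mod (K : fieldType) (A : comAlgType K) : Type :=
  derivation A.

Section DerivationModule.
Variables (K : fieldType) (A : comAlgType K).

HB.instance Definition _ := GRing.Zmodule.copy (derivation_mod A) (derivation A).

Fact der_scaleA (f g : A) (D : derivation_mod A) :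
  der_scale f (der_scale g D) = der_scale (f * g) D.
Proof. by apply: derivationP => h; rewrite /= mulrA. Qed.
Fact der_scale1 : left_id (1 : A) (@der_scale K A).
Proof. by move=> D; apply: derivationP => h; rewrite /= mul1r. Qed.
Fact der_scaleDr : right_distributive (@der_scale K A) +%R.
Proof. by move=> f D E; apply: derivationP => h; exact: mulrDr. Qed.
Fact der_scaleDl (D : derivation_mod A) :
  {morph (@der_scale K A)^~ D : f g / f + g}.
Proof. by move=> f g; apply: derivationP => h; exact: mulrDl. Qed.

HB.instance Definition _ := GRing.Zmodule_isLmodule.Build A (derivation_mod A)
  der_scaleA der_scale1 der_scaleDr der_scaleDl.

End DerivationModule.

(* W_n(K), as a Lie algebra over K and as a module over K[x_1, ..., x_n]. *)
Notation "''W_' n ( K )" := (derivation {mpoly K[n]})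
  (at level 8, n at level 2, format "''W_' n ( K )") : type_scope.
Notation "''W^mod_' n ( K )" := (derivation_mod {mpoly K[n]})
  (at level 8, n at level 2, format "''W^mod_' n ( K )") : type_scope.

Section PolynomialDerivations.
Variables (K : fieldType) (n : nat).

Lemma partial_subproof (p : 'I_n) :
  (mderiv p : {mpoly K[n]} -> {mpoly K[n]})
    \in @derivation_pred K {mpoly K[n]}.
Proof.
by apply/asboolP; split=> [|f g]; [exact: mderiv_is_linear | exact: mderivM].
Qed.

Definition partial (p : 'I_n) : 'W_n(K) := Derivation (partial_subproof p).

Definition basic_subalgebra (S : set 'W_n(K)) : Prop :=
  [/\ lie_subalgebra S,
      exists e : 'I_n -> 'W_n(K), is_basis S e &
      forall e : 'I_n -> 'W_n(K), is_basis S e ->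
        is_basis (M := 'W^mod_n(K)) setT e].

Definition jacobian (w : 'I_n -> {mpoly K[n]}) : 'M[{mpoly K[n]}]_n :=
  \matrix_(i, j) mderiv j (w i).

End PolynomialDerivations.

(* A (x)_K L, for finite-dimensional L, is represented by the coordinate
   families with respect to the A-basis 1 (x) e_i, where e is the basis
   [vbasis fullv] of L; [tens_basis] below shows that any other basis of L
   would do as well. *)
Definition tensor (K : fieldType) (A : comAlgType K) (L : lieVectType K) :
    Type :=
  {ffun 'I_(\dim {:L}) -> A}.

Section Tensor.
Variables (K : fieldType) (A : comAlgType K) (L : lieVectType K).
Notation T := (tensor A L).
Notation e := (vbasis {:L}).
Implicit Types (f g : A) (x y z : L) (w u v : T).

HB.instance Definition _ := GRing.Lmodule.copy T {ffun 'I_(\dim {:L}) -> A}.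

Definition tens f x : T := [ffun k => coord e k x *: f].

Definition tensor_lie w u : T :=
  \sum_i \sum_j tens (w i * u j) (lie e`_i e`_j).

Lemma tensDl f g x : tens (f + g) x = tens f x + tens g x.
Proof. by apply/ffunP=> k; rewrite !ffunE scalerDr. Qed.
Lemma tensDr f x y : tens f (x + y) = tens f x + tens f y.
Proof. by apply/ffunP=> k; rewrite !ffunE linearD scalerDl. Qed.
Lemma tensZl (a : K) f x : tens (a *: f) x = a *: tens f x.
Proof. by apply/ffunP=> k; rewrite !ffunE !scalerA mulrC. Qed.
Lemma tensZr (a : K) f x : tens f (a *: x) = a *: tens f x.
Proof. by apply/ffunP=> k; rewrite !ffunE linearZ scalerA. Qed.
Lemma tens0l x : tens 0 x = 0.
Proof. by apply/ffunP=> k; rewrite !ffunE scaler0. Qed.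
Lemma tens0r f : tens f 0 = 0.
Proof. by apply/ffunP=> k; rewrite !ffunE linear0 scale0r. Qed.
Lemma tens_sumr I (r : seq I) (P : pred I) (F : I -> L) f :
  tens f (\sum_(i <- r | P i) F i) = \sum_(i <- r | P i) tens f (F i).
Proof. exact: (big_morph _ (tensDr f) (tens0r f)). Qed.
Lemma tens_suml I (r : seq I) (P : pred I) (F : I -> A) x :
  tens (\sum_(i <- r | P i) F i) x = \sum_(i <- r | P i) tens (F i) x.
Proof. exact: (big_morph (tens^~ x) (fun f g => tensDl f g x) (tens0l x)). Qed.

Lemma tensor_sumE w : w = \sum_i tens (w i) e`_i.
Proof.
apply/ffunP=> k; rewrite sum_ffunE (bigD1 k) //= big1 => [|i ik].
  by rewrite addr0 ffunE coord_free ?eqxx ?scale1r // (basis_free (vbasisP _)).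
rewrite ffunE coord_free ?(basis_free (vbasisP _)) //.
by rewrite (negPf ik) scale0r.
Qed.

Lemma tensor_lie_tens f g x y :
  tensor_lie (tens f x) (tens g y) = tens (f * g) (lie x y).
Proof.
have xE z : z = \sum_i coord e i z *: e`_i.
  exact: coord_basis (vbasisP _) (memvf z).
have lie_suml (F : 'I_(\dim {:L}) -> L) z :
    lie (\sum_i F i) z = \sum_i lie (F i) z.
  by apply: (big_morph (lie^~ z) (fun a b => lieDl a b z) (lie0l z)).
have lie_sumr (F : 'I_(\dim {:L}) -> L) z :
    lie z (\sum_i F i) = \sum_i lie z (F i).
  exact: (big_morph _ (lieDr z) (lie0r z)).
rewrite [in RHS](xE x) lie_suml tens_sumr; apply: eq_bigr => i _.
rewrite [in RHS](xE y) lie_sumr tens_sumr; apply: eq_bigr => j _.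
rewrite lieZl lieZr !tensZr !ffunE -!tensZl -scalerAl -scalerAr.
by rewrite !scalerA.
Qed.

Lemma tensor_lieDl w u v : tensor_lie (w + u) v = tensor_lie w v + tensor_lie u v.
Proof.
rewrite -big_split; apply: eq_bigr => i _; rewrite -big_split.
by apply: eq_bigr => j _; rewrite ffunE mulrDl tensDl.
Qed.
Lemma tensor_lieDr w u v : tensor_lie w (u + v) = tensor_lie w u + tensor_lie w v.
Proof.
rewrite -big_split; apply: eq_bigr => i _; rewrite -big_split.
by apply: eq_bigr => j _; rewrite ffunE mulrDr tensDl.
Qed.
Lemma tensor_lie0l v : tensor_lie 0 v = 0.
Proof. by apply: (addrI (tensor_lie 0 v)); rewrite -tensor_lieDl !addr0. Qed.
Lemma tensor_lie0r v : tensor_lie v 0 = 0.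
Proof. by apply: (addrI (tensor_lie v 0)); rewrite -tensor_lieDr !addr0. Qed.

Lemma tensor_lie_linearl v : linear (tensor_lie^~ v).
Proof.
move=> a w u; rewrite tensor_lieDl; congr (_ + _).
rewrite scaler_sumr; apply: eq_bigr => i _; rewrite scaler_sumr.
by apply: eq_bigr => j _; rewrite ffunE -scalerAl tensZl.
Qed.
Lemma tensor_lie_linearr w : linear (tensor_lie w).
Proof.
move=> a u v; rewrite tensor_lieDr; congr (_ + _).
rewrite scaler_sumr; apply: eq_bigr => i _; rewrite scaler_sumr.
by apply: eq_bigr => j _; rewrite ffunE -scalerAr tensZl.
Qed.

Lemma tensor_ind (P : T -> Prop) :
    P 0 -> (forall w u, P w -> P u -> P (w + u)) ->
    (forall f x, P (tens f x)) -> forall w, P w.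
Proof.
by move=> P0 PD Pt w; rewrite [w]tensor_sumE; apply: big_ind => // i _.
Qed.

Lemma tensor_lie_anti w u : tensor_lie w u + tensor_lie u w = 0.
Proof.
elim/tensor_ind: w => [|w1 w2 IH1 IH2|f x].
- by rewrite tensor_lie0l tensor_lie0r addr0.
- by rewrite tensor_lieDl tensor_lieDr addrACA IH1 IH2 addr0.
elim/tensor_ind: u => [|u1 u2 IH1 IH2|g y].
- by rewrite tensor_lie0l tensor_lie0r addr0.
- by rewrite tensor_lieDl tensor_lieDr addrACA IH1 IH2 addr0.
by rewrite !tensor_lie_tens [g * f]mulrC -tensDr lie_anti tens0r.
Qed.

Lemma tensor_liexx w : tensor_lie w w = 0.
Proof.
elim/tensor_ind: w => [|w1 w2 IH1 IH2|f x].
- exact: tensor_lie0l.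
- by rewrite tensor_lieDl !tensor_lieDr IH1 IH2 add0r addr0 tensor_lie_anti.
by rewrite tensor_lie_tens liexx tens0r.
Qed.

Lemma tensor_jacobi w u v :
  tensor_lie w (tensor_lie u v) + tensor_lie u (tensor_lie v w)
  + tensor_lie v (tensor_lie w u) = 0.
Proof.
have D3 (a b c a' b' c' : T) : a + b + c = 0 -> a' + b' + c' = 0 ->
    (a + a') + (b + b') + (c + c') = 0.
  by move=> H H'; rewrite (addrACA a) (addrACA (a + b)) H H' addr0.
elim/tensor_ind: w => [|w1 w2 IH1 IH2|f x].
- by rewrite !(tensor_lie0l, tensor_lie0r) !addr0.
- by rewrite !(tensor_lieDl, tensor_lieDr); apply: D3.
elim/tensor_ind: u => [|u1 u2 IH1 IH2|g y].
- by rewrite !(tensor_lie0l, tensor_lie0r) !addr0.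
- by rewrite !(tensor_lieDl, tensor_lieDr); apply: D3.
elim/tensor_ind: v => [|v1 v2 IH1 IH2|h z].
- by rewrite !(tensor_lie0l, tensor_lie0r) !addr0.
- by rewrite !(tensor_lieDl, tensor_lieDr); apply: D3.
rewrite !tensor_lie_tens.
have -> : h * (f * g) = f * (g * h) by ring.
have -> : g * (h * f) = f * (g * h) by ring.
by rewrite -!tensDr lie_jacobi tens0r.
Qed.

HB.instance Definition _ := Lmodule_isLie.Build K T
  tensor_lie_linearl tensor_lie_linearr tensor_liexx tensor_jacobi.

Lemma lie_tens f g x y :
  lie (tens f x) (tens g y) = tens (f * g) (lie x y) :> T.
Proof. exact: tensor_lie_tens. Qed.

Lemma tens_basis n (l : n.-tuple L) : basis_of {:L} l ->
  (forall w, exists v : 'I_n -> A, w = \sum_i tens (v i) l`_i) /\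
  (forall v : 'I_n -> A, \sum_i tens (v i) l`_i = 0 -> forall i, v i = 0).
Proof.
move=> lb; have free_l := basis_free lb.
split=> [|v v0 i].
  elim/tensor_ind => [|w1 w2 [v1 ->] [v2 ->]|f x].
  - by exists (fun=> 0); rewrite big1 // => i _; rewrite tens0l.
  - exists (fun i => v1 i + v2 i); rewrite -big_split.
    by apply: eq_bigr => i _; rewrite tensDl.
  exists (fun i => coord l i x *: f).
  rewrite [x in LHS](coord_basis lb (memvf x)) tens_sumr.
  by apply: eq_bigr => i _; rewrite tensZr tensZl.
pose F (w : T) : A := \sum_(k < \dim {:L}) coord l i e`_k *: w k.
have FD w u : F (w + u) = F w + F u.
  by rewrite -big_split; apply: eq_bigr => k _; rewrite ffunE scalerDr.
have F0 : F 0 = 0 by rewrite /F big1 // => k _; rewrite ffunE scaler0.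
have Ft f x : F (tens f x) = coord l i x *: f.
  rewrite [x in RHS](coord_basis (vbasisP _) (memvf x)) linear_sum scaler_suml.
  by apply: eq_bigr => k _; rewrite ffunE scalerA linearZ mulrC.
move/(congr1 F): v0; rewrite (big_morph F FD F0) F0 (bigD1 i) //= Ft big1.
  by rewrite coord_free // eqxx scale1r addr0.
move=> j ji; rewrite Ft coord_free //.
by rewrite (negPf ji) scale0r.
Qed.

End Tensor.

Arguments tens {K A L}.

(* The derivation D (x) id of A (x)_K L. *)
Definition tensor_der (K : fieldType) (A : comAlgType K) (L : lieVectType K)
    (D : derivation A) (w : tensor A L) : tensor A L := [ffun k => D (w k)].

Lemma tensor_der_sum (K : fieldType) (A : comAlgType K) (L : lieVectType K)
    (D : derivation A) n (f : 'I_n -> A) (x : 'I_n -> L) :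
  tensor_der D (\sum_i tens (f i) (x i)) = \sum_i tens (D (f i)) (x i).
Proof.
apply/ffunP=> k; rewrite ffunE !sum_ffunE linear_sum.
by apply: eq_bigr => i _; rewrite !ffunE linearZ.
Qed.

(* s = \sum_(i >= 1) u i, all but finitely many terms being zero;
   u 0 plays no role. *)
Definition has_finite_sum (M : zmodType) (u : nat -> M) (s : M) : Prop :=
  exists N, (forall i, (N <= i)%N -> u i = 0) /\ s = \sum_(1 <= i < N) u i.

(* Main.v *)
(* For w in R (x) L the elements \sum_(i >= 1) 1/i! (ad w)^(i-1) (- d_p w), formally
   - (d_p e^w) e^(-w), satisfy the zero-curvature equation
     d_p b_q - d_q b_p + [b_p, b_q] = 0.
   On the other hand, if d_p = \sum_j b_pj D_j with (b_pj) invertible, then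
   expanding [d_p, d_q] = 0 shows that this equation is equivalent to
   [D_i, D_j] = \sum_k c_ij^k D_k.  In a triangular basis of L the matrix of the
   series is - J(w)^T times a unitriangular matrix.
   (1) Take w = \sum_i x_i (x) l_i: the D_j obtained by inverting (b_pj) span a
   basic copy of L.
   (2) The given b_p have zero curvature; w is found one coordinate at a time,
   the bracket involving only the earlier ones, so that each new coordinate is
   the primitive of a closed polynomial 1-form.  As (b_pj) is invertible,
   det J(w) is a unit of R. *)

Require Import Defs.
From HB Require Import structures.
From mathcomp Require Import all_boot all_order all_algebra.
From mathcomp Require Import boolp classical_sets functions.
From mathcomp Require Import mpoly.

Set Implicit Arguments.
Unset Strict Implicit.
Unset Printing Implicit Defensive.

Import GRing.Theory.
Local Open Scope ring_scope.

(** * Primitives of closed polynomial 1-forms *)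

Lemma mcoeff_rescale (R : nzRingType) n (E : 'X_{1..n} -> R) (p : {mpoly R[n]}) :
  exists q : {mpoly R[n]}, forall m, q@_m = E m * p@_m.
Proof.
elim/mpolyind: p => [|c m p _ _ [q qE]].
  by exists 0 => m; rewrite !mcoeff0 mulr0.
exists ((E m * c) *: 'X_[m] + q) => k.
rewrite !mcoeffD !mcoeffZ mcoeffX qE mulrDr.
by case: eqP => [->|_]; rewrite ?mulr1 // !mulr0.
Qed.

Lemma mcoeff_euler (R : comNzRingType) n (p : {mpoly R[n]}) m :
  (\sum_(i < n) 'X_i * p^`M(i))@_m = (mdeg m)%:R * p@_m.
Proof.
elim/mpolyind: p => [|c k p _ _ IH].
  by rewrite mcoeff0 mulr0 big1 ?mcoeff0 // => i _; rewrite mderiv0 mulr0.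
under eq_bigr => i _ do rewrite mderivD mderivZ mulrDr -scalerAr mderivX.
rewrite big_split /= mcoeffD IH mcoeffD mcoeffZ mulrDr mcoeffX; congr (_ + _).
have -> : \sum_(i < n) c *: ('X_i * ((k i)%:R *: 'X_[k - U_(i)]))
    = (c * (mdeg k)%:R) *: 'X_[R, k].
  rewrite mdegE natr_sum mulr_sumr scaler_suml; apply: eq_bigr => i _.
  rewrite -scalerAr -mpolyXD scalerA.
  have [->|k0] := eqVneq (k i) 0; first by rewrite mulr0 !scale0r.
  by rewrite addmC submK // lep1mP.
rewrite mcoeffZ mcoeffX; case: eqP => [->|_]; last by rewrite !mulr0.
by rewrite mulr1 mulrC mulr1.
Qed.

(* Homotopy: dividing the coefficients of h = \sum_p x_p f_p by their degree
   gives a primitive, since d_p h = f_p + E f_p with E the Euler operator. *)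
Lemma poly_poincare (K : fieldType) (charK : [pchar K] =i pred0) n
    (f : 'I_n -> {mpoly K[n]}) :
  (forall p q, (f q)^`M(p) = (f p)^`M(q)) ->
  exists u : {mpoly K[n]}, forall p, u^`M(p) = f p.
Proof.
move=> fC; pose h := \sum_q 'X_q * f q.
(* In degree 0 the convention [0^-1 = 0] merely makes the constant term of [u] zero. *)
have [u uE] := mcoeff_rescale (fun m => (mdeg m)%:R^-1) h.
exists u => p; apply/mpolyP=> m.
have hp : h^`M(p) = f p + \sum_q 'X_q * (f p)^`M(q).
  rewrite raddf_sum /=.
  under eq_bigr => q _ do rewrite mderivM fC.
  rewrite big_split /=; congr (_ + _).
  rewrite (bigD1 p) //= big1 => [|q qp]; rewrite mderivX mnm1E.
    by rewrite eqxx scale1r -[X in (X - _)%MM]add0m addmK mpolyX0 mul1r addr0.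
  by rewrite (negPf qp) scale0r mul0r.
(* At [m] the identity [hp] reads: [m p + 1] times the coefficient of [h] at [m + U_(p)] is
   [mdeg m + 1] times that of [f p] at [m]. Since [mdeg (m + U_(p)) = mdeg m + 1] is nonzero in
   characteristic 0, it cancels the factor introduced in [u]. *)
have := congr1 (mcoeff m) hp.
rewrite mcoeffD mcoeff_euler !mcoeff_deriv uE mdegD mdeg1 addn1.
rewrite -mulrnAr => ->; rewrite -[X in X + _]mul1r -mulrDl -mulrS mulKf //.
by move/pcharf0P: charK => ->.
Qed.

(** * Truncation and Cauchy products of finitely supported sums *)

Lemma big_ord_trunc (V : nmodType) (f : nat -> V) N M : (N <= M)%N ->
  (forall i, (N <= i)%N -> f i = 0) -> \sum_(i < M) f i = \sum_(i < N) f i.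
Proof.
move=> /subnKC<- f0; rewrite big_split_ord /= [X in _ + X]big1 ?addr0 // => i _.
by rewrite f0 ?leq_addr.
Qed.

(** The square of indices is summed along the antidiagonals [i + j = m - 1], the one for [m = 0]
    being empty. For fixed [i] the substitution [m = i + j + 1] recovers the sum over [j]. *)
Lemma big_cauchy (V : nmodType) (f : nat -> nat -> V) N :
  (forall i j, (N <= i)%N -> f i j = 0) ->
  (forall i j, (N <= j)%N -> f i j = 0) ->
  \sum_(m < (N + N).+1) \sum_(i < m) f i (m.-1 - i)%N
    = \sum_(i < N) \sum_(j < N) f i j.
Proof.
move=> f0l f0r; set M := (N + N).+1.
under eq_bigr => m _ do
  rewrite (big_ord_widen M (fun i => f i (m.-1 - i)%N) (ltnW (ltn_ord m))).
rewrite (exchange_big_dep predT) //=.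
rewrite (@big_ord_trunc _ (fun i => \sum_(m < M | (i < m)%N) f i (m.-1 - i)%N) N) //.
- apply: eq_bigr => i _.
  rewrite -(big_geq_mkord _ _ predT (fun m => f i (m.-1 - i)%N)).
  rewrite -[X in index_iota X]addn0 addnC big_addn.
  rewrite (eq_bigr (fun j => f i j)) => [|j _]; last by rewrite addnS addnK.
  rewrite big_mkord; apply: big_ord_trunc => [|j]; last exact: f0r.
  by rewrite /M subSS -addnBA ?leq_addr // ltnW.
- by rewrite leqW // leq_addr.
- by move=> i Ni; rewrite big1 // => m _; rewrite f0l.
Qed.

(** * Zero curvature of the exponential series *)

Section MaurerCartan.
Variables (K : fieldType) (charK : [pchar K] =i pred0) (V : lieAlgType K).
Implicit Types (d : {linear V -> V}) (x y w : V).

Lemma mulrnS_eq0 x n : x *+ n.+1 = 0 -> x = 0.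
Proof.
rewrite -scaler_nat => /eqP; rewrite scaler_eq0 => /orP[|/eqP//].
by move/pcharf0P: charK => ->.
Qed.

Lemma lieMnl n x y : lie (x *+ n) y = lie x y *+ n.
Proof. by rewrite -!scaler_nat lieZl. Qed.
Lemma lieMnr n x y : lie x (y *+ n) = lie x y *+ n.
Proof. by rewrite -!scaler_nat lieZr. Qed.
Lemma lie_suml I r (P : pred I) (F : I -> V) y :
  lie (\sum_(i <- r | P i) F i) y = \sum_(i <- r | P i) lie (F i) y.
Proof. exact: (big_morph (lie^~ y) (fun a b => lieDl a b y) (lie0l y)). Qed.
Lemma lie_sumr I r (P : pred I) (F : I -> V) x :
  lie x (\sum_(i <- r | P i) F i) = \sum_(i <- r | P i) lie x (F i).
Proof. exact: (big_morph _ (lieDr x) (lie0r x)). Qed.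
Lemma lieNl x y : lie (- x) y = - lie x y.
Proof. by rewrite -scaleN1r lieZl scaleN1r. Qed.
Lemma lieNr x y : lie x (- y) = - lie x y.
Proof. by rewrite -scaleN1r lieZr scaleN1r. Qed.
Lemma lieC x y : lie x y = - lie y x.
Proof. by apply/eqP; rewrite -addr_eq0 lie_anti. Qed.
Lemma lie_leibniz w x y : lie w (lie x y) = lie (lie w x) y + lie x (lie w y).
Proof.
apply/eqP; rewrite -subr_eq0 opprD addrA -(lie_jacobi w x y).
by rewrite [lie y (lie w x)]lieC [lie y w]lieC lieNr addrAC.
Qed.

(** For commuting derivations [d1], [d2], the commutator of the connections [d1 + ad x1] and
    [d2 + ad x2] is [ad] of this element. *)
Definition curvature d1 d2 x1 x2 := d1 x2 - d2 x1 + lie x1 x2.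

Definition lie_derivation d := forall x y, d (lie x y) = lie (d x) y + lie x (d y).

(** For [i >= 1], the coefficient of t^i in the formal expression - d(e^(tw)) e^(-tw). *)
Definition dexp_term d w i := (i`!%:R : K)^-1 *: iter i.-1 (lie w) (- d w).

Lemma dexp_term1 d w : dexp_term d w 1 = - d w.
Proof. by rewrite /dexp_term invr1 scale1r. Qed.

(** With [dexp_term1] as constant term, this is the differential equation x' = [w, x] - d w read on
    coefficients. *)
Lemma dexp_termS d w i :
  dexp_term d w i.+2 *+ i.+2 = lie w (dexp_term d w i.+1).
Proof.
rewrite /dexp_term /= lieZr -scaler_nat scalerA; congr (_ *: _).
rewrite factS natrM invfM mulrA mulfV ?mul1r //.
by move/pcharf0P: charK => ->.
Qed.

Variables (d1 d2 : {linear V -> V}) (w : V).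
Hypotheses (der1 : lie_derivation d1) (der2 : lie_derivation d2).
Hypothesis d12 : d1 (d2 w) = d2 (d1 w).

Let a i := dexp_term d1 w i.+1.
Let b i := dexp_term d2 w i.+1.

(* The coefficient of t^(m+1) in the curvature of the family
   x_j(t) = \sum_i t^(i+1) dexp_term d_j w (i+1), which solves
   x_j' = [w, x_j] - d_j w; hence the curvature F satisfies F' = [w, F]. *)
Let G m := d1 (b m) - d2 (a m) + \sum_(i < m) lie (a i) (b (m.-1 - i)%N).

(** The equation F' = [w, F] gives [G m.+1 *+ m.+2 = lie w (G m)], and [G 0 = 0] because [d1] and
    [d2] commute on [w]; characteristic 0 allows division by [m.+2]. *)
Lemma curvature_coef0 m : G m = 0.
Proof.
(* Product rule for the bracket of two series: the weight [m' + 2] splits as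
   [(i + 1) + (m' - i + 1)]. The extreme terms, where [dexp_term1] applies, give the brackets with
   [d1 w] and [d2 w]; on the others [dexp_termS] applies, and Leibniz for [lie w] reassembles
   them. *)
have cauchy m' :
    (\sum_(i < m'.+1) lie (a i) (b (m' - i)%N)) *+ m'.+2 =
    lie w (\sum_(i < m') lie (a i) (b (m'.-1 - i)%N))
    - lie (d1 w) (b m') - lie (a m') (d2 w).
  have -> : (\sum_(i < m'.+1) lie (a i) (b (m' - i)%N)) *+ m'.+2 =
    \sum_(i < m'.+1) lie (a i *+ i.+1) (b (m' - i)%N) +
    \sum_(i < m'.+1) lie (a i) (b (m' - i)%N *+ (m' - i).+1).
    rewrite -big_split /= -sumrMnl; apply: eq_bigr => i _.
    rewrite lieMnl lieMnr -mulrnDr addSn addnS subnKC //.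
    by rewrite -ltnS ltn_ord.
  rewrite big_ord_recl [X in _ + X = _]big_ord_recr /= subn0 subnn.
  rewrite {1}/a {4}/b !dexp_term1 lieNl lieNr.
  have -> : \sum_(i < m') lie (a (bump 0 i) *+ (bump 0 i).+1) (b (m' - bump 0 i)%N)
     = \sum_(i < m') lie (lie w (a i)) (b (m'.-1 - i)%N).
    apply: eq_bigr => i _; rewrite /bump add1n /a dexp_termS.
    by case: (m') i => [[]//|k i]; rewrite subSS.
  have -> : \sum_(i < m') lie (a i) (b (m' - i)%N *+ (m' - i).+1)
     = \sum_(i < m') lie (a i) (lie w (b (m'.-1 - i)%N)).
    apply: eq_bigr => i _; case: (m') i => [[]//|k i].
    by rewrite /= subSn -1?ltnS // /b dexp_termS.
  rewrite lie_sumr; under [X in _ = X - _ - _]eq_bigr => i _ do rewrite lie_leibniz.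
  by rewrite big_split /= [X in X + _]addrC addrACA !addrA.
elim: m => [|m IH].
  rewrite /G big_ord0 addr0 /a /b !dexp_term1 !linearN d12 opprK.
  by rewrite addNr.
apply: (@mulrnS_eq0 _ m.+1); rewrite /G mulrnDl /= cauchy mulrnBl.
have -> : d1 (b m.+1) *+ m.+2 = d1 (lie w (b m)).
  by rewrite -raddfMn /b dexp_termS.
have -> : d2 (a m.+1) *+ m.+2 = d2 (lie w (a m)).
  by rewrite -raddfMn /a dexp_termS.
rewrite der1 der2.
(* The 0 on the right becomes [lie w (G m)], so that the recurrence itself is to be proved. The
   brackets with [d1 w] and [d2 w] coming from [der1] and [der2] cancel those of [cauchy]. *)
have := congr1 (lie w) IH; rewrite lie0r /G !lieDr lieNr => {2}<-.
rewrite [lie (d2 w) _]lieC.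
set A := lie (d1 w) _; set B := lie w (d1 _).
set C := lie (a m) _; set D := lie w (d2 _).
rewrite opprD opprK.
by rewrite [LHS](AC (2*2*3) ((1*6)*(3*7)*(2*4*5))) /= !subrr !add0r.
Qed.



(** Evaluation at t = 1: the curvature of the sums is the sum of the [G m]. The index shift turns
    the bound [N] into [N'], and [M] is large enough for the Cauchy product. *)
Lemma curvature_dexp N :
  (forall i, (N <= i)%N -> dexp_term d1 w i = 0) ->
  (forall i, (N <= i)%N -> dexp_term d2 w i = 0) ->
  curvature d1 d2 (\sum_(1 <= i < N) dexp_term d1 w i)
                  (\sum_(1 <= i < N) dexp_term d2 w i) = 0.
Proof.
move=> a0 b0; pose N' := N.-1; pose M := (N' + N').+1.
have shift d : \sum_(1 <= i < N) dexp_term d w i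
    = \sum_(i < N') dexp_term d w i.+1.
  rewrite big_add1 big_mkord //.
have {}a0 i : (N' <= i)%N -> a i = 0.
  by move=> Ni; apply: a0; rewrite -ltnS in Ni; apply: leq_trans Ni; exact: leqSpred.
have {}b0 i : (N' <= i)%N -> b i = 0.
  by move=> Ni; apply: b0; rewrite -ltnS in Ni; apply: leq_trans Ni; exact: leqSpred.
have N'M : (N' <= M)%N by rewrite leqW // leq_addr.
have : \sum_(m < M) G m = 0 by rewrite big1 // => m _; exact: curvature_coef0.
rewrite !big_split /= sumrN (@big_cauchy _ (fun i j => lie (a i) (b j)) N').
- rewrite -!linear_sum (big_ord_trunc N'M a0) (big_ord_trunc N'M b0).
  move=> G0; rewrite /curvature !shift lie_suml -[RHS]G0; congr (_ + _).
  by apply: eq_bigr => i _; rewrite lie_sumr.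
- by move=> i j /a0->; exact: lie0l.
- by move=> i j /b0->; exact: lie0r.
Qed.

End MaurerCartan.

(** * Nilpotency, iterated brackets and scalar extension *)

Section LowerCentral.
Variables (K : fieldType) (V : lieAlgType K).

Lemma lower_central_iter (w u : V) k : lower_central k (iter k (lie w) u).
Proof.
elim: k => // k IH; exists 1, (fun=> 1), (fun=> w), (fun=> iter k (lie w) u).
by split=> //; rewrite big_ord1 scale1r.
Qed.

Lemma lie_nilpotent_iter : lie_nilpotent V ->
  exists N, forall (w u : V) k, (N <= k)%N -> iter k (lie w) u = 0.
Proof.
case=> N N0; exists N => w u k /subnKC<-; rewrite addnC iterD.
elim: (k - N)%N => [|m IH] /=; last by rewrite IH lie0r.
by apply: N0; exact: lower_central_iter.
Qed.

End LowerCentral.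

Section NilpotentTensor.
Variables (K : fieldType) (A : comAlgType K) (L : lieVectType K).

(* The k-th term of the lower central series of A (x) L is A (x) that of L, put as
   an induction principle. *)
Lemma lower_central_tensor_ind k (P : tensor A L -> Prop) :
    P 0 -> (forall a w u, P w -> P u -> P (a *: w + u)) ->
    (forall f x, lower_central k x -> P (tens f x)) ->
  forall w, lower_central k w -> P w.
Proof.
elim: k P => [|k IH] P P0 PZD Pt w /=.
  move=> _; apply: tensor_ind => // [u v Pu Pv|f x]; last exact: Pt.
  by rewrite -[u]scale1r; exact: PZD.
case=> m [c [u [v [_ kv ->]]]].
(* The induction hypothesis, taken for the predicate [P (lie (u i) z)] in [z], reduces the right
   argument to a pure tensor; [tensor_ind] then reduces the left one. *)
have lieP i : P (lie (u i) (v i)).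
  apply: (IH (fun z => P (lie (u i) z))) (kv i).
  - by rewrite lie0r.
  - by move=> a z z' Pz Pz'; rewrite lieDr lieZr; exact: PZD.
  move=> f x kx; elim/tensor_ind: (u i) => [|z z' Pz Pz'|g y].
  - by rewrite lie0l.
  - by rewrite lieDl -[lie z _]scale1r; exact: PZD.
  rewrite lie_tens; apply: Pt; exists 1, (fun=> 1), (fun=> y), (fun=> x).
  by split=> //; rewrite big_ord1 scale1r.
by apply: big_ind => // [z z' Pz Pz'|i _];
  [rewrite -[z]scale1r | rewrite -[_ *: _]addr0]; exact: PZD.
Qed.

Lemma tensor_nilpotent : lie_nilpotent L -> lie_nilpotent (tensor A L).
Proof.
case=> k k0; exists k; apply: lower_central_tensor_ind => // [a w u -> ->|f x].
  by rewrite scaler0 addr0.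
by move/k0->; rewrite tens0r.
Qed.

End NilpotentTensor.

(** * Triangular bases of nilpotent Lie algebras *)

Section TriangularBasis.
Variables (K : fieldType) (L : lieVectType K).

(** The space [L, U], given as a [vspace] so that the lower central series has bases and
    complements. *)
Definition lcv_step (U : {vspace L}) : {vspace L} :=
  <<[seq lie x y | x <- vbasis {:L}, y <- vbasis U]>>%VS.

Lemma lcv_stepP (U : {vspace L}) x y : y \in U -> lie x y \in lcv_step U.
Proof.
move=> yU; rewrite (coord_vbasis (memvf x)) lie_suml rpred_sum // => i _.
rewrite lieZl rpredZ // (coord_vbasis yU) lie_sumr rpred_sum // => j _.
rewrite lieZr rpredZ //; apply/memv_span/allpairsP.
by exists ((vbasis {:L})`_i, (vbasis U)`_j); rewrite !mem_nth ?size_tuple.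
Qed.

Lemma lcv_lower_central k x : x \in iter k lcv_step fullv -> lower_central k x.
Proof.
elim: k x => // k IH x /= xk.
pose X := [seq lie y z | y <- vbasis {:L}, z <- vbasis (iter k lcv_step fullv)].
have /choice[p pP] (i : 'I_(size X)) : exists p : L * L,
    lower_central k p.2 /\ X`_i = lie p.1 p.2.
  have /allpairsP[p [_ p2 ->]] := mem_nth 0 (ltn_ord i).
  by exists p; split=> //; apply: IH; exact: vbasis_mem.
exists (size X), (fun i => coord (in_tuple X) i x),
  (fun i => (p i).1), (fun i => (p i).2).
split=> // [i|]; first by have [] := pP i.
rewrite {1}(coord_span (X := in_tuple X) xk); apply: eq_bigr => i _.
by have [_ ->] := pP i.
Qed.

Lemma lcv_step_sub (U W : {vspace L}) : (U <= W)%VS -> (lcv_step U <= lcv_step W)%VS.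
Proof.
move=> UW; apply/span_subvP => z /allpairsP[p [_ p2 ->]].
by apply: lcv_stepP; apply: (subvP UW); exact: vbasis_mem.
Qed.

(** Going up from [Z N = 0], a basis of a complement of [Z k.+1] in [Z k] is put in front of the
    basis of [Z k.+1] already built. A bracket with a new vector lies in [Z k.+1], the span of the
    older ones. *)
Lemma lie_nilpotent_triangular_basis : lie_nilpotent L ->
  exists2 s : seq L, basis_of {:L} s &
    forall (i : nat) x, lie x s`_i \in <<drop i.+1 s>>%VS.
Proof.
case=> N N0; pose Z k := iter k lcv_step fullv.
have ZS k : (Z k.+1 <= Z k)%VS.
  by elim: k => [|k IH]; [exact: subvf | exact: lcv_step_sub].
suff: forall m, (m <= N)%N -> exists2 s : seq L, basis_of (Z (N - m)%N) s &
    forall (i : nat) x, lie x s`_i \in <<drop i.+1 s>>%VS.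
  by move/(_ N (leqnn N)); rewrite subnn.
elim=> [_|m IH mN].
  exists [::] => [|i x]; last by rewrite nth_nil lie0r mem0v.
  rewrite basisEdim span_nil subn0 andbT; apply/subvP=> x /lcv_lower_central/N0->.
  exact: mem0v.
have [s sb sP] := IH (ltnW mN).
set k := (N - m.+1)%N; have kE : (N - m)%N = k.+1 by rewrite subnSK.
rewrite kE in sb; pose t := vbasis (Z k :\: Z k.+1)%VS.
have lieZ i x : lie x t`_i \in <<s>>%VS.
  rewrite (span_basis sb); have [it|it] := ltnP i (size t); last first.
    by rewrite nth_default // lie0r mem0v.
  apply: lcv_stepP; apply: (subvP (diffvSl _ (Z k.+1))).
  by apply: vbasis_mem; exact: mem_nth.
exists (t ++ s) => [|i x].
  suff: basis_of (Z k :\: Z k.+1 + Z k.+1) (t ++ s).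
    by rewrite addv_diff (addv_idPl (ZS k)).
  apply: cat_basis => //; last exact: vbasisP.
  by apply/directv_addP; exact: capv_diff.
rewrite nth_cat drop_cat; case: (ltnP i (size t)) => it; last first.
  by rewrite ltnNge (leq_trans it) //= subSn.
case: ltnP => it'.
  by apply: subvP (lieZ i x); apply: sub_span => z zs; rewrite mem_cat zs orbT.
(* Here [i] is the last index of [t], so exactly [t] is dropped. *)
have -> : (i.+1 - size t = 0)%N by apply/eqP; rewrite subn_eq0.
by rewrite drop0.
Qed.

End TriangularBasis.

(** * Coordinates and filtration of A (x) L in a triangular basis *)

Section TensorCoordinates.
Variables (K : fieldType) (A : comAlgType K) (L : lieVectType K).
Variables (n : nat) (l : n.-tuple L).
Hypothesis lb : basis_of {:L} l.
Notation T := (tensor A L).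
Implicit Types (w u v z : T) (D : derivation A).

Lemma tensor_der_is_linear D : linear (@tensor_der K A L D).
Proof. by move=> a w u; apply/ffunP=> k; rewrite !ffunE derivation_linear. Qed.
HB.instance Definition _ D :=
  GRing.isLinear.Build K T T *:%R (tensor_der D) (tensor_der_is_linear D).

Lemma tensor_der_tens D f (x : L) : tensor_der D (tens f x) = tens (D f) x.
Proof. by apply/ffunP=> k; rewrite !ffunE linearZ. Qed.

Lemma tensor_der_lie D : lie_derivation (@tensor_der K A L D).
Proof.
move=> w u /=; elim/tensor_ind: w => [|w1 w2 IH1 IH2|f x].
- by rewrite lie0l linear0 !lie0l addr0.
- by rewrite lieDl !linearD /= IH1 IH2 !lieDl addrACA.
elim/tensor_ind: u => [|u1 u2 IH1 IH2|g y].
- by rewrite lie0r linear0 !lie0r addr0.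
- by rewrite lieDr !linearD /= IH1 IH2 !lieDr addrACA.
by rewrite lie_tens !tensor_der_tens !lie_tens derivationM tensDl.
Qed.

(** The coordinate along 1 (x) l_k: a change of basis, since tensors are stored by their coordinates
    along [vbasis {:L}]. *)
Definition tcoord (k : 'I_n) w : A :=
  \sum_(i < \dim {:L}) coord l k (vbasis {:L})`_i *: w i.

Lemma tcoord_is_linear k : linear (tcoord k).
Proof.
move=> a w u; rewrite scaler_sumr -big_split /=; apply: eq_bigr => i _.
by rewrite !ffunE scalerDr !scalerA mulrC.
Qed.
HB.instance Definition _ k :=
  GRing.isLinear.Build K T A *:%R (tcoord k) (tcoord_is_linear k).

Lemma tcoord_tens k f x : tcoord k (tens f x) = coord l k x *: f.
Proof.
rewrite [x in RHS](coord_vbasis (memvf x)) linear_sum scaler_suml.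
by apply: eq_bigr => i _; rewrite ffunE scalerA linearZ mulrC.
Qed.

Lemma tcoord_sum k (f : 'I_n -> A) : tcoord k (\sum_(i < n) tens (f i) l`_i) = f k.
Proof.
rewrite linear_sum (bigD1 k) //= big1 => [|i ik];
  rewrite tcoord_tens coord_free ?(basis_free lb) //.
  by rewrite eqxx scale1r addr0.
by rewrite (negPf ik) scale0r.
Qed.

Lemma tensor_coordE w : w = \sum_(i < n) tens (tcoord i w) l`_i.
Proof.
have [/(_ w)[v ->] _] := tens_basis A lb.
by apply: eq_bigr => i _; rewrite tcoord_sum.
Qed.

Lemma tcoordP w u : (forall k, tcoord k w = tcoord k u) -> w = u.
Proof.
by move=> wu; rewrite [w]tensor_coordE [u]tensor_coordE;
  apply: eq_bigr => i _; rewrite wu.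
Qed.

Lemma tcoord_der k D w : tcoord k (tensor_der D w) = D (tcoord k w).
Proof.
by rewrite linear_sum; apply: eq_bigr => i _; rewrite ffunE linearZ.
Qed.

Lemma tcoord_lie k w u : tcoord k (lie w u) =
  \sum_(i < n) \sum_(j < n) coord l k (lie l`_i l`_j) *: (tcoord i w * tcoord j u).
Proof.
rewrite {1}[w]tensor_coordE {1}[u]tensor_coordE lie_suml linear_sum.
apply: eq_bigr => i _; rewrite lie_sumr linear_sum; apply: eq_bigr => j _.
by rewrite lie_tens /= tcoord_tens.
Qed.

Hypothesis lie_tri :
  forall i j k : 'I_n, (k <= maxn i j)%N -> coord l k (lie l`_i l`_j) = 0.

(** Membership in A (x) <l_m, ..., l_(n-1)>, an ideal by [lie_tri]; bracketing with any element
    raises [m] by one. *)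
Definition tfilt m w := forall k : 'I_n, (k < m)%N -> tcoord k w = 0.

Lemma tfiltD m w u : tfilt m w -> tfilt m u -> tfilt m (w + u).
Proof. by move=> mw mu k km; rewrite linearD /= mw ?mu ?addr0. Qed.

Lemma tfilt_der m D w : tfilt m w -> tfilt m (tensor_der D w).
Proof. by move=> mw k km; rewrite tcoord_der mw // linear0. Qed.

Lemma tfiltW m w : tfilt m.+1 w -> tfilt m w.
Proof. by move=> mw k km; rewrite mw // ltnW. Qed.

Lemma tfilt_lier m w u : tfilt m u -> tfilt m.+1 (lie w u).
Proof.
move=> mu k km; rewrite tcoord_lie big1 // => i _; rewrite big1 // => j _.
have [jm|jm] := ltnP j m; first by rewrite mu // mulr0 scaler0.
by rewrite lie_tri ?scale0r // leq_max (leq_trans _ jm) ?orbT.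
Qed.

Lemma tfilt_liel m w u : tfilt m w -> tfilt m.+1 (lie w u).
Proof. by move=> mw k km; rewrite lieC linearN /= (tfilt_lier _ mw) ?oppr0. Qed.

(** Hence coordinate [m] of a bracket depends only on the coordinates below [m] of its arguments,
    which makes a coordinatewise solution possible. *)
Lemma tfilt_lieB m w w' u u' :
  tfilt m (w - w') -> tfilt m (u - u') -> tfilt m.+1 (lie w u - lie w' u').
Proof.
move=> mw mu; have -> : lie w u - lie w' u' = lie (w - w') u + lie w' (u - u').
  by rewrite lieDl lieDr lieNl lieNr addrA subrK.
by apply: tfiltD; [exact: tfilt_liel | exact: tfilt_lier].
Qed.

Definition dexp D w N := \sum_(1 <= i < N) dexp_term (tensor_der D) w i.

(** Only the linear term - D w of the series feels [z] at level [m]: every later term has one more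
    bracket, which pushes the change into level [m.+1]. *)
Lemma tcoord_dexpD m D w z N : (1 < N)%N -> tfilt m z ->
  tfilt m.+1 (dexp D (w + z) N - dexp D w N + tensor_der D z).
Proof.
case: N => [|[|N]] // _ mz.
have low i : tfilt m (iter i (lie (w + z)) (- tensor_der D (w + z))
                      - iter i (lie w) (- tensor_der D w)).
  elim: i => [|i IH] /=; last first.
    by apply/tfiltW/tfilt_lieB => //; rewrite addrC addKr.
  rewrite linearD /= opprD addrAC subrr add0r => k km.
  by rewrite linearN /= (@tfilt_der m) ?oppr0.
rewrite /dexp (@big_ltn _ _ _ 1%N) // (@big_ltn _ _ _ 1%N) // !dexp_term1.
rewrite linearD /= opprD.
set S1 := \sum_(2 <= i < _) _; set S2 := \sum_(2 <= i < _) _.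
(* The change - D z of the first term cancels against the added D z; the terms of index at least 2
   remain. *)
rewrite [X in tfilt _ X](_ : _ = S1 - S2); last first.
  rewrite opprD opprK [LHS](AC (3*2*1) ((1*4)*(2*6)*(3*5))) /=.
  by rewrite addNr addNr !add0r.
rewrite -sumrB big_nat; elim/big_ind: _ => [k _|x y|i /andP[i2 _] k km].
- exact: linear0.
- exact: tfiltD.
rewrite /dexp_term -scalerBr linearZ /=.
case: i i2 => [|[|i]] // _; rewrite (@tfilt_lieB m) ?scaler0 //.
- by rewrite addrC addKr.
- exact: low.
Qed.

Definition trow u : 'rV[A]_n := \row_k tcoord k u.

Lemma trow_is_additive : zmod_morphism trow.
Proof. by move=> u v; apply/rowP=> k; rewrite !mxE linearB. Qed.
HB.instance Definition _ :=
  GRing.isZmodMorphism.Build T 'rV[A]_n trow trow_is_additive.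

Lemma trowZ (a : K) u : trow (a *: u) = a%:A *: trow u.
Proof. by apply/rowP=> k; rewrite !mxE linearZ /= mulr_algl. Qed.

(** The matrix of ad w acting on coordinate rows from the right. *)
Definition adM w : 'M[A]_n :=
  \matrix_(j, k) \sum_(i < n) coord l k (lie l`_i l`_j) *: tcoord i w.

Lemma trow_lie w u : trow (lie w u) = trow u *m adM w.
Proof.
apply/rowP=> k; rewrite !mxE tcoord_lie exchange_big; apply: eq_bigr => j _.
rewrite !mxE mulr_sumr; apply: eq_bigr => i _.
by rewrite -scalerAr mulrC.
Qed.

(** The matrix of the truncated series (e^(ad w) - 1) / ad w; the iterate is a power of [adM w]. *)
Definition dexpM w N : 'M[A]_n :=
  \sum_(1 <= i < N)
    (i`!%:R^-1 : K)%:A *: iter i.-1 (mulmx^~ (adM w)) 1%:M.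

Lemma trow_dexp D w N : trow (dexp D w N) = - trow (tensor_der D w) *m dexpM w N.
Proof.
rewrite raddf_sum mulmx_sumr; apply: eq_bigr => i _.
rewrite /= trowZ -scalemxAr; congr (_ *: _).
have -> : - trow (tensor_der D w) = trow (- tensor_der D w) by rewrite raddfN.
elim: i.-1 => [|m IH] /=; first by rewrite mulmx1.
by rewrite trow_lie IH mulmxA.
Qed.

(** [adM w] is strictly upper triangular, and so are its positive powers; on and below the diagonal
    only the identity, the term [i = 1], contributes. *)
Lemma dexpM_low w N (j k : 'I_n) : (1 < N)%N -> (k <= j)%N ->
  dexpM w N j k = (j == k)%:R.
Proof.
have adM0 (a b : 'I_n) : (b <= a)%N -> adM w a b = 0.
  move=> ba; rewrite mxE big1 // => i _.
  by rewrite lie_tri ?scale0r // leq_max ba orbT.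
have low m (a b : 'I_n) : (b < a + m)%N -> iter m (mulmx^~ (adM w)) 1%:M a b = 0.
  elim: m a b => [|m IH] a b /=.
    by rewrite addn0 mxE => ba; case: eqP ba => // ->; rewrite ltnn.
  rewrite addnS ltnS mxE => ba; rewrite big1 // => i _.
  have [ia|ai] := ltnP i (a + m); first by rewrite IH // mul0r.
  by rewrite adM0 ?mulr0 // (leq_trans ba).
case: N => [|[|N]] // _ kj; rewrite /dexpM big_ltn // mxE summxE big_nat big1.
  by rewrite addr0 invr1 scale1r mxE mul1r mxE.
case=> [|[|i]] // _; rewrite mxE low ?mulr0 //.
by rewrite (leq_ltn_trans kj) // -[X in (X < _)%N]addn0 ltn_add2l.
Qed.

Lemma det_dexpM w N : (1 < N)%N -> \det (dexpM w N) = 1.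
Proof.
move=> N1; rewrite -det_tr det_trig.
  by rewrite big1 // => i _; rewrite mxE dexpM_low // eqxx.
apply/is_trig_mxP=> j k jk; rewrite mxE (dexpM_low _ N1 (ltnW jk)).
by rewrite -val_eqE gtn_eqF.
Qed.

End TensorCoordinates.

(** * Evaluation of derivations *)

Section DerivationModuleEval.
Variables (K : fieldType) (A : comAlgType K).

Lemma derivation_sumE I r (P : pred I) (E : I -> derivation A) f :
  (\sum_(i <- r | P i) E i) f = \sum_(i <- r | P i) E i f.
Proof. exact: (big_morph (fun D : derivation A => D f) (fun _ _ => erefl) erefl). Qed.

Lemma derivation_mod_sumE n (a : 'I_n -> A) (E : 'I_n -> derivation A) f :
  ((\sum_i a i *: (E i : derivation_mod A) : derivation_mod A) : derivation A) f
    = \sum_i a i * E i f.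
Proof.
exact: (big_morph (fun D : derivation_mod A => (D : derivation A) f)
  (fun _ _ => erefl) erefl).
Qed.

Lemma derivation1 (D : derivation A) : D 1 = 0.
Proof.
by apply: (addrI (D 1)); rewrite addr0 -{3}[1]mulr1 derivationM mulr1 mul1r.
Qed.

End DerivationModuleEval.

Lemma mpoly_derivation_ext (K : fieldType) n (D E : 'W_n(K)) :
  (forall i, D 'X_i = E 'X_i) -> D = E.
Proof.
move=> DE; apply: derivationP; elim/mpolyind => [|c m p _ _ IH].
  by rewrite !linear0.
rewrite !linearD !linearZ /= IH; congr (_ *: _ + _).
rewrite mpolyXE_id; elim/big_ind: _ => [|x y Dx Dy|i _].
- by rewrite !derivation1.
- by rewrite !derivationM Dx Dy.
elim: (m i) => [|k IHk]; first by rewrite expr0 !derivation1.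
by rewrite exprS !derivationM DE IHk.
Qed.

(** * Frames of W_n(K): structure constants and zero curvature *)

Section FlatFrames.
Variables (K : fieldType) (n : nat).
Local Notation R := {mpoly K[n]}.
Variables (L : lieVectType K) (l : n.-tuple L).
Hypothesis lb : basis_of {:L} l.
Variables (D : 'I_n -> 'W_n(K)) (b : 'I_n -> tensor R L).
Notation B := (\matrix_(p, j) tcoord l j (b p)).
Hypothesis partialE : forall p f, partial K p f = \sum_j tcoord l j (b p) * D j f.

(** Evaluating [partialE] at the variables exhibits an explicit inverse of the coefficient
    matrix. *)
Lemma frame_mulmx1 : B *m \matrix_(j, q) D j 'X_q = 1%:M.
Proof.
apply/matrixP=> p q; rewrite !mxE.
under eq_bigr => j _ do rewrite !mxE.
rewrite -partialE /= mderivX mnm1E eq_sym.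
case: eqP => [->|_]; last by rewrite scale0r.
by rewrite scale1r -[X in (X - _)%MM]add0m addmK mpolyX0.
Qed.

(* d_p d_q f = d_q d_p f, expanded in the frame D. *)
Lemma frame_curvature p q f :
  \sum_k (partial K p (tcoord l k (b q)) - partial K q (tcoord l k (b p))) * D k f
  + \sum_i \sum_j tcoord l i (b p) * tcoord l j (b q) * lie (D i) (D j) f = 0.
Proof.
have expand p' q' : partial K p' (partial K q' f)
   = \sum_k partial K p' (tcoord l k (b q')) * D k f
     + \sum_i \sum_j tcoord l i (b p') * tcoord l j (b q') * D i (D j f).
  rewrite (partialE q') [LHS]linear_sum exchange_big -big_split.
  apply: eq_bigr => k _.
  rewrite [LHS](derivationM (partial K p')); congr (_ + _).
  rewrite partialE mulr_sumr.
  by apply: eq_bigr => i _; rewrite mulrA [_ * tcoord l i _]mulrC.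
have : partial K p (partial K q f) - partial K q (partial K p f) = 0.
  by rewrite /= mderiv_comm subrr.
rewrite !expand opprD addrACA -sumrB.
under eq_bigr => k _ do rewrite -mulrBl.
move=> E0; rewrite -[RHS]E0; congr (_ + _); rewrite [X in _ - X]exchange_big -sumrB.
apply: eq_bigr => i _; rewrite -sumrB; apply: eq_bigr => j _.
by rewrite [_ (b q) * _]mulrC -mulrBr.
Qed.

Let tpartial p : {linear tensor R L -> tensor R L} := tensor_der (partial K p).
Definition flat := forall p q, curvature (tpartial p) (tpartial q) (b p) (b q) = 0.

Lemma tcoord_curvature p q k :
  tcoord l k (curvature (tpartial p) (tpartial q) (b p) (b q)) =
  partial K p (tcoord l k (b q)) - partial K q (tcoord l k (b p))
  + \sum_(i < n) \sum_(j < n)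
      coord l k (lie l`_i l`_j) *: (tcoord l i (b p) * tcoord l j (b q)).
Proof.
by rewrite /curvature !linearD linearN /= !tcoord_der (tcoord_lie lb).
Qed.

Let defect i j f :=
  lie (D i) (D j) f - \sum_k coord l k (lie l`_i l`_j) *: D k f.

(** Adding and subtracting the expected brackets in [frame_curvature] separates the curvature from
    the defect. As [B] is invertible, one vanishes exactly when the other does. *)
Lemma frame_defect p q f :
  \sum_k tcoord l k (curvature (tpartial p) (tpartial q) (b p) (b q)) * D k f
  + \sum_i \sum_j tcoord l i (b p) * tcoord l j (b q) * defect i j f = 0.
Proof.
rewrite -[RHS](frame_curvature p q f).
under eq_bigr => k _ do rewrite tcoord_curvature mulrDl.
rewrite big_split /= -addrA; congr (_ + _).
under [X in _ + X = _]eq_bigr => i _ do under eq_bigr => j _ do rewrite mulrBr.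
under [X in _ + X = _]eq_bigr => i _ do rewrite sumrB.
rewrite sumrB addrC -addrA -[RHS]addr0; congr (_ + _).
rewrite addrC; apply/eqP; rewrite subr_eq0; apply/eqP.
under eq_bigr => k _ do rewrite mulr_suml.
rewrite exchange_big /=; apply: eq_bigr => i _.
under eq_bigr => k _ do rewrite mulr_suml.
rewrite exchange_big /=; apply: eq_bigr => j _.
rewrite [RHS]mulr_sumr; apply: eq_bigr => k _.
by rewrite -scalerAl -scalerAr.
Qed.

(** With zero defect, the row [r] of curvature coordinates is killed by the invertible matrix of the
    [D j 'X_s]. *)
Lemma frame_flat :
  (forall i j, lie (D i) (D j) = \sum_k coord l k (lie l`_i l`_j) *: D k) -> flat.
Proof.
move=> DD p q; apply: (tcoordP lb) => k; rewrite linear0.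
pose r := \row_k' tcoord l k' (curvature (tpartial p) (tpartial q) (b p) (b q)).
suff r0 : r = 0 by have /rowP/(_ k) := r0; rewrite !mxE.
rewrite -[r]mulmx1 -(mulmx1C frame_mulmx1) mulmxA.
suff -> : r *m \matrix_(j, s) D j 'X_s = 0 by rewrite mul0mx.
apply/rowP=> s; rewrite !mxE -[RHS](frame_defect p q 'X_s).
rewrite [X in _ = _ + X]big1 ?addr0 => [|i _].
  by apply: eq_bigr => j _; rewrite !mxE.
by rewrite big1 // => j _; rewrite /defect DD derivation_sumE subrr mulr0.
Qed.

Lemma flat_frame : flat ->
  forall i j, lie (D i) (D j) = \sum_k coord l k (lie l`_i l`_j) *: D k.
Proof.
move=> b0 i j; apply: derivationP => f; apply/eqP.
rewrite derivation_sumE -subr_eq0 -/(defect i j f).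
pose E := \matrix_(i', j') defect i' j' f.
suff E0 : E = 0 by have /matrixP/(_ i j) := E0; rewrite !mxE => ->.
set M := \matrix_(j', q) D j' 'X_q; have MB := mulmx1C frame_mulmx1.
(* The double sum in [frame_defect] is the entry [(p, q)] of [B *m E *m B^T], and [M] inverts
   [B]. *)
have -> : E = M *m (B *m E *m B^T) *m M^T.
  by rewrite !mulmxA MB mul1mx -mulmxA -trmx_mul MB trmx1 mulmx1.
suff -> : B *m E *m B^T = 0 by rewrite mulmx0 mul0mx.
apply/matrixP=> p q; rewrite !mxE -[RHS](frame_defect p q f).
rewrite [X in _ = X + _]big1 ?add0r => [|k _].
  rewrite exchange_big; apply: eq_bigr => j' _; rewrite !mxE mulr_suml.
  by apply: eq_bigr => i' _; rewrite !mxE mulrAC.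
by rewrite b0 linear0 mul0r.
Qed.

End FlatFrames.

(** * Every flat family is an exponential series *)

Section FlatExponential.
Variables (K : fieldType) (charK : [pchar K] =i pred0) (n : nat).
Local Notation R := {mpoly K[n]}.
Variables (L : lieVectType K) (l : n.-tuple L).
Hypothesis lb : basis_of {:L} l.
Implicit Types (w z : tensor R L) (b : 'I_n -> tensor R L).
Notation dp := (partial K).

Lemma tensor_partial_comm p q w :
  tensor_der (dp p) (tensor_der (dp q) w) = tensor_der (dp q) (tensor_der (dp p) w).
Proof. by apply/ffunP=> k; rewrite !ffunE /= mderiv_comm. Qed.

Variable N : nat.
Hypothesis N_gt1 : (1 < N)%N.
Hypothesis nilp : forall w u k, (N.-1 <= k)%N -> iter k (lie w) u = 0.

Lemma dexp_term_eq0 (d : {linear tensor R L -> tensor R L}) w i :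
  (N <= i)%N -> dexp_term d w i = 0.
Proof.
by move=> Ni; rewrite /dexp_term nilp ?scaler0 // -!subn1 leq_sub2r.
Qed.

Lemma dexp_flat w : flat (fun p => dexp (dp p) w N).
Proof.
move=> p q; apply: curvature_dexp => //; try exact: tensor_der_lie.
- exact: tensor_partial_comm.
- by move=> i; exact: dexp_term_eq0.
- by move=> i; exact: dexp_term_eq0.
Qed.

Hypothesis lie_tri :
  forall i j k : 'I_n, (k <= maxn i j)%N -> coord l k (lie l`_i l`_j) = 0.

Lemma det_dexp w :
  \det (\matrix_(p, j) tcoord l j (dexp (dp p) w N))
    = (-1) ^+ n * \det (jacobian (fun i => tcoord l i w)).
Proof.
pose J := jacobian (fun i => tcoord l i w).
have -> : (\matrix_(p, j) tcoord l j (dexp (dp p) w N)) = - J^T *m dexpM l w N.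
  apply/row_matrixP=> p; rewrite row_mul.
  have -> : row p (- J^T) = - trow l (tensor_der (dp p) w).
    by apply/rowP=> k; rewrite !mxE tcoord_der.
  by rewrite -trow_dexp //; apply/rowP=> k; rewrite !mxE.
by rewrite det_mulmx (det_dexpM lie_tri) // mulr1 -scaleN1r detZ det_tr.
Qed.

(** The coordinates below [m] already agree. Coordinate [m] of the discrepancy is a closed 1-form,
    and its primitive corrects [w] along l_m. *)
Lemma flat_dexp_extend b w m : flat b -> (m < n)%N ->
  (forall p, tfilt l m (b p - dexp (dp p) w N)) ->
  exists w', forall p, tfilt l m.+1 (b p - dexp (dp p) w' N).
Proof.
move=> b0 mn bw; pose k := Ordinal mn.
pose bk p := tcoord l k (b p); pose ek p := tcoord l k (dexp (dp p) w N).
have tcurv (x y : tensor R L) p q :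
    tcoord l k (curvature (tensor_der (dp p)) (tensor_der (dp q)) x y)
    = dp p (tcoord l k y) - dp q (tcoord l k x) + tcoord l k (lie x y).
  by rewrite /curvature linearD linearB /= !tcoord_der.
(* Both families have zero curvature, and by [tfilt_lieB] their brackets agree in coordinate [m]; so
   do the remaining terms of the curvature. *)
have bE p q : dp p (bk q) - dp q (bk p) = dp p (ek q) - dp q (ek p).
  have lieE : tcoord l k (lie (b p) (b q))
      = tcoord l k (lie (dexp (dp p) w N) (dexp (dp q) w N)).
    apply/eqP; rewrite -subr_eq0 -linearB /=.
    by rewrite (tfilt_lieB lb lie_tri (bw p) (bw q)).
  apply: (addIr (tcoord l k (lie (b p) (b q)))); rewrite -tcurv b0 lieE -tcurv.
  by rewrite dexp_flat.
have fC p q : (ek q - bk q)^`M(p) = (ek p - bk p)^`M(q).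
  rewrite !mderivB; apply/eqP.
  by rewrite subr_eq -addrA [- _ + _]addrC addrC -subr_eq; apply/eqP/esym/bE.
have [u uE] := poly_poincare charK fC.
(* Adding [z] changes coordinate [m] of the series by [- dp p u = bk p - ek p], and no earlier
   coordinate. *)
pose z : tensor R L := tens u l`_k.
have zk j : tcoord l j z = (j == k)%:R * u.
  rewrite /z tcoord_tens coord_free ?(basis_free lb) //.
  by rewrite mulr_natl scaler_nat eq_sym.
have zm : tfilt l m z.
  by move=> j jm; rewrite zk; case: eqP jm => [->|]; rewrite ?mul0r //= ltnn.
exists (w + z) => p j jm.
have := tcoord_dexpD lb lie_tri (dp p) w N_gt1 zm jm.
rewrite !linearB !linearD /= linearN /= tcoord_der zk.
have [->|jk] := eqVneq j k.
  rewrite mul1r /= uE addrA subrK => /eqP.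
  by rewrite subr_eq0 => /eqP->; rewrite subrr.
rewrite mul0r linear0 addr0 => /eqP; rewrite subr_eq0 => /eqP->.
rewrite -linearB; apply: bw.
by move: jm; rewrite ltnS leq_eqVlt => /orP[/eqP jE|//]; case/eqP: jk; apply: val_inj.
Qed.

Lemma flat_dexp b : flat b -> exists w, forall p, b p = dexp (dp p) w N.
Proof.
move=> b0.
have [w wP] : exists w, forall p, tfilt l n (b p - dexp (dp p) w N).
  suff: forall m, (m <= n)%N ->
    exists w, forall p, tfilt l m (b p - dexp (dp p) w N) by apply.
  elim=> [|m IH] mn; first by exists 0.
  by have [w wP] := IH (ltnW mn); exact: flat_dexp_extend wP.
exists w => p; apply: (tcoordP lb) => k; apply/eqP; rewrite -subr_eq0 -linearB /=.
by rewrite wP.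
Qed.

End FlatExponential.

(** * Frames as bases of the R-module W_n(K) *)

Section FrameBasis.
Variables (K : fieldType) (n : nat).
Local Notation R := {mpoly K[n]}.
Variables (D : 'I_n -> 'W_n(K)) (B : 'M[R]_n).
Hypothesis BD : B *m \matrix_(j, q) D j 'X_q = 1%:M.

Lemma frame_free (r : 'I_n -> R) : (forall f, \sum_j r j * D j f = 0) ->
  forall j, r j = 0.
Proof.
move=> rD j; suff r0 : \row_i r i = 0 by have /rowP/(_ j) := r0; rewrite !mxE.
rewrite -[LHS]mulmx1 -(mulmx1C BD) mulmxA.
suff -> : \row_i r i *m \matrix_(i, q) D i 'X_q = 0 by rewrite mul0mx.
apply/rowP=> q; rewrite !mxE -[RHS](rD 'X_q).
by apply: eq_bigr => i _; rewrite !mxE.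
Qed.

Lemma frame_span (E : 'W_n(K)) :
  exists r : 'I_n -> R, forall f, E f = \sum_j r j * D j f.
Proof.
(* From E = \sum_p E(x_p) d_p and the expansion of d_p in the frame with coefficients [B p j]. *)
pose r j := \sum_p E 'X_p * B p j; exists r => f.
suff -> : E = (\sum_j r j *: (D j : 'W^mod_n(K)) : 'W^mod_n(K)).
  by rewrite derivation_mod_sumE.
apply: mpoly_derivation_ext => q; rewrite derivation_mod_sumE.
under eq_bigr => j _ do rewrite mulr_suml.
rewrite exchange_big /= (bigD1 q) //= [X in _ = _ + X]big1 ?addr0 => [|p pq].
  have /matrixP/(_ q q) := BD; rewrite !mxE eqxx => Bq.
  rewrite -[LHS]mulr1 -[1]Bq mulr_sumr; apply: eq_bigr => j _.
  by rewrite mxE mulrA.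
have /matrixP/(_ p q) := BD; rewrite !mxE (negPf pq) => Bq.
rewrite -[RHS](mulr0 (E 'X_p)) -[X in _ = _ * X]Bq mulr_sumr; apply: eq_bigr => j _.
by rewrite mxE mulrA.
Qed.

Lemma frame_scalar_free (a : 'I_n -> K) : \sum_j a j *: D j = 0 ->
  forall j, a j = 0.
Proof.
move=> aD j; apply/eqP.
suff: (a j)%:A == 0 :> R by rewrite scaler_eq0 oner_eq0 orbF.
apply/eqP; apply: (frame_free (r := fun j => (a j)%:A)) => f.
have aDf := congr1 (fun E : 'W_n(K) => E f) aD.
rewrite -[RHS]aDf derivation_sumE.
by apply: eq_bigr => i _; rewrite mulr_algl.
Qed.

(** Two K-bases of one space differ by an invertible scalar matrix, so spanning and freeness over R
    pass from [D] to [e]. *)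
Lemma frame_basis_mod (S : set 'W_n(K)) (e : 'I_n -> 'W_n(K)) :
  is_basis S D -> is_basis S e -> is_basis (M := 'W^mod_n(K)) setT e.
Proof.
case=> SD spanD _ [Se span_e free_e].
have [a eE] : exists a : 'I_n -> 'I_n -> K, forall i, e i = \sum_j a i j *: D j.
  by have /choice[a aP] := fun i => spanD _ (Se i); exists a.
have [c DE] : exists c : 'I_n -> 'I_n -> K, forall j, D j = \sum_i c j i *: e i.
  by have /choice[c cP] := fun j => span_e _ (SD j); exists c.
have eE' i f : e i f = \sum_j a i j *: D j f by rewrite eE derivation_sumE.
have DE' j f : D j f = \sum_i c j i *: e i f by rewrite DE derivation_sumE.
split=> // [v _|r re k].
  have [r vE] := frame_span v.
  exists (fun i => \sum_j c j i *: r j); apply: derivationP => f.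
  rewrite derivation_mod_sumE vE.
  under eq_bigr => j _ do rewrite DE' mulr_sumr.
  rewrite exchange_big; apply: eq_bigr => i _ /=; rewrite mulr_suml.
  by apply: eq_bigr => j _; rewrite -scalerAr scalerAl.
have ra j : \sum_i a i j *: r i = 0.
  apply: (frame_free (r := fun j => \sum_i a i j *: r i)) => f.
  have := congr1 (fun E : 'W^mod_n(K) => (E : 'W_n(K)) f) re.
  rewrite derivation_mod_sumE derivation_0E => ref; rewrite -[RHS]ref.
  under eq_bigr => i _ do rewrite mulr_suml.
  rewrite exchange_big; apply: eq_bigr => i _ /=; rewrite eE' mulr_sumr.
  by apply: eq_bigr => j' _; rewrite -scalerAr scalerAl.
(* The matrices [a] and [c] are inverse, by uniqueness of coordinates along [e]; a row with
   [r a = 0] then satisfies [r = r a c = 0]. *)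
have ac i : \sum_j a i j * c j k = (i == k)%:R.
  apply/eqP; rewrite -subr_eq0; apply/eqP.
  apply: (free_e (fun k => \sum_j a i j * c j k - (i == k)%:R)).
  under eq_bigr => m _ do rewrite scalerBl scaler_suml.
  rewrite sumrB exchange_big /=.
  rewrite [X in _ - X](bigD1 i) //= eqxx scale1r.
  rewrite [X in _ - (_ + X)]big1 ?addr0.
    rewrite [X in _ - X]eE -sumrB big1 // => j _.
    rewrite [X in _ - _ *: X]DE scaler_sumr.
    by apply/eqP; rewrite subr_eq0; apply/eqP/eq_bigr => m _; rewrite scalerA.
  by move=> m mi; rewrite eq_sym (negPf mi) scale0r.
have -> : r k = \sum_j c j k *: \sum_i a i j *: r i.
  under eq_bigr => j _ do rewrite scaler_sumr.
  rewrite exchange_big /= (bigD1 k) //= [X in _ = _ + X]big1 ?addr0 => [|i ik].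
    under eq_bigr => j _ do rewrite scalerA mulrC.
    by rewrite -scaler_suml ac eqxx scale1r.
  under eq_bigr => j _ do rewrite scalerA mulrC.
  by rewrite -scaler_suml ac (negPf ik) scale0r.
by rewrite big1 // => j _; rewrite ra scaler0.
Qed.

End FrameBasis.

Lemma coord_span_drop (K : fieldType) (V : vectType K) n (l : n.-tuple V) m x
    (k : 'I_n) :
  free l -> x \in <<drop m l>>%VS -> (k < m)%N -> coord l k x = 0.
Proof.
move=> lf xd km; rewrite (coord_span (X := in_tuple (drop m l)) xd) linear_sum.
apply: big1 => i _; rewrite linearZ /= nth_drop.
have mi : (m + i < n)%N.
  by rewrite -ltn_subRL; apply: leq_trans (ltn_ord i) _; rewrite size_drop size_tuple.
rewrite -[(m + i)%N]/(nat_of_ord (Ordinal mi)) coord_free //.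
rewrite -val_eqE /= gtn_eqF ?mulr0 //.
by rewrite (leq_trans km) ?leq_addr.
Qed.

Lemma mpoly_unitP (K : fieldType) n (p : {mpoly K[n]}) :
  p \is a GRing.unit -> exists2 a : K, a != 0 & p = a%:MP_[n].
Proof. by case/andP=> /eqP pE; rewrite unitfE => p0; exists p@_0. Qed.

(** * The basic subalgebra spanned by a frame *)

Section FrameMap.
Variables (K : fieldType) (n : nat) (L : lieVectType K) (l : n.-tuple L).
Hypothesis lb : basis_of {:L} l.
Variables (D : 'I_n -> 'W_n(K)) (B : 'M[{mpoly K[n]}]_n).
Hypothesis BD : B *m \matrix_(j, q) D j 'X_q = 1%:M.
Hypothesis lieD :
  forall i j, lie (D i) (D j) = \sum_k coord l k (lie l`_i l`_j) *: D k.

Definition frame_map (x : L) : 'W_n(K) := \sum_(j < n) coord l j x *: D j.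

Lemma frame_map_is_linear : linear frame_map.
Proof.
move=> a x y; rewrite scaler_sumr -big_split; apply: eq_bigr => j _.
by rewrite linearP scalerDl scalerA.
Qed.
HB.instance Definition _ :=
  GRing.isLinear.Build K L 'W_n(K) *:%R frame_map frame_map_is_linear.

Lemma frame_map_inj : injective frame_map.
Proof.
move=> x y xy; apply/eqP; rewrite -subr_eq0; apply/eqP.
rewrite (coord_basis lb (memvf (x - y))) big1 // => j _.
have /(frame_scalar_free BD)-> : \sum_j coord l j (x - y) *: D j = 0.
  by rewrite -/(frame_map (x - y)) linearB /= xy subrr.
by rewrite scale0r.
Qed.

Lemma frame_map_basis (j : 'I_n) : frame_map l`_j = D j.
Proof.
rewrite /frame_map (bigD1 j) //= big1 => [|i ij];
  rewrite coord_free ?(basis_free lb) //.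
  by rewrite eqxx scale1r addr0.
by rewrite eq_sym (negPf ij) scale0r.
Qed.

Lemma frame_map_lie x y : frame_map (lie x y) = lie (frame_map x) (frame_map y).
Proof.
rewrite {1}(coord_basis lb (memvf x)) {1}(coord_basis lb (memvf y)).
rewrite lie_suml linear_sum [in RHS]/frame_map lie_suml; apply: eq_bigr => i _.
rewrite lie_sumr linear_sum lie_sumr; apply: eq_bigr => j _.
by rewrite !lieZl !linearZ /= !lieZr linearZ /= lieD.
Qed.

Lemma frame_map_basic : basic_subalgebra (range frame_map).
Proof.
have SD : is_basis (range frame_map) D.
  split=> [j|_ [x _ <-]|]; last exact: frame_scalar_free BD.
    by exists l`_j => //; exact: frame_map_basis.
  by exists (fun j => coord l j x).
split; [split=> [|a _ _ [x _ <-] [y _ <-]|_ _ [x _ <-] [y _ <-]]| |].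
- by exists 0 => //; exact: linear0.
- by exists (a *: x + y) => //; exact: linearP.
- by exists (lie x y) => //; exact: frame_map_lie.
- by exists D.
- by move=> e eB; exact: (frame_basis_mod BD SD eB).
Qed.

Lemma frame_map_iso : lie_iso_onto frame_map (range frame_map).
Proof. by split=> //; [exact: frame_map_inj | exact: frame_map_lie]. Qed.

End FrameMap.

(** * Realization and the form of all realizations *)

Lemma tensor_nilpotent_iter (K : fieldType) (A : comAlgType K) (L : lieVectType K) :
  lie_nilpotent L -> exists2 N, (1 < N)%N &
    forall (w u : tensor A L) k, (N.-1 <= k)%N -> iter k (lie w) u = 0.
Proof.
move=> /(@tensor_nilpotent _ A)/lie_nilpotent_iter[N N0].
(* The first increment accounts for the exponent [i.-1] of term [i]; the second ensures that term 1
   is in the sum. *)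
by exists N.+2 => // w u k Nk; apply: N0; exact: ltnW.
Qed.

Lemma nilpotent_basic_realization (K : fieldType) (charK : [pchar K] =i pred0) n
    (L : lieVectType K) :
  lie_nilpotent L -> \dim {:L} = n ->
  exists2 Lbar : set 'W_n(K), basic_subalgebra Lbar &
    exists phi : {linear L -> 'W_n(K)}, lie_iso_onto phi Lbar.
Proof.
move=> nilL dimL; have [s sb sP] := lie_nilpotent_triangular_basis nilL.
have sn : size s == n by rewrite -(eqP (basis_free sb)) (span_basis sb) dimL.
pose l : n.-tuple L := Tuple sn.
have lb : basis_of {:L} l := sb.
have tri (i j k : 'I_n) : (k <= maxn i j)%N -> coord l k (lie l`_i l`_j) = 0.
  (* [sP] controls the right argument of the bracket; the case [k <= i] follows by antisymmetry. *)
  rewrite leq_max => /orP[] kij; last first.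
    by apply: (coord_span_drop (basis_free lb) (sP j _)).
  rewrite lieC linearN /= (coord_span_drop (basis_free lb) (sP i _)) ?oppr0 //.
have [N N1 nilT] := @tensor_nilpotent_iter _ {mpoly K[n]} _ nilL.
(* The coordinates of [w] are the variables, so its Jacobian matrix is the identity and [B] has
   determinant (-1)^n. *)
pose w : tensor {mpoly K[n]} L := \sum_(i < n) tens 'X_i l`_i.
pose b p := dexp (partial K p) w N.
pose B := \matrix_(p, j) tcoord l j (b p).
have B_unit : B \in unitmx.
  rewrite unitmxE (det_dexp lb N1 tri).
  have -> : jacobian (fun i => tcoord l i w) = 1%:M.
    apply/matrixP=> i j; rewrite !mxE tcoord_sum // mderivX mnm1E.
    case: eqP => [->|_]; last by rewrite scale0r.
    by rewrite scale1r -[X in (X - _)%MM]add0m addmK mpolyX0.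
  by rewrite det1 mulr1 unitrX // unitrN1.
pose D j : 'W_n(K) :=
  (\sum_p invmx B j p *: (partial K p : 'W^mod_n(K)) : 'W^mod_n(K)).
have DE j f : D j f = \sum_p invmx B j p * partial K p f.
  exact: derivation_mod_sumE.
have partialE p f : partial K p f = \sum_j tcoord l j (b p) * D j f.
  under eq_bigr => j _ do rewrite DE mulr_sumr.
  have BV q : \sum_j tcoord l j (b p) * invmx B j q = (p == q)%:R.
    have /matrixP/(_ p q) := mulmxV B_unit; rewrite !mxE => BVpq.
    by rewrite -[RHS]BVpq; apply: eq_bigr => j _; rewrite !mxE.
  rewrite exchange_big; under eq_bigr => q _.
    under eq_bigr => j _ do rewrite mulrA.
    rewrite -mulr_suml BV; over.
  rewrite (bigD1 p) //= eqxx mul1r big1 ?addr0 // => q qp.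
  by rewrite eq_sym (negPf qp) mul0r.
have lieD := flat_frame lb partialE (dexp_flat charK nilT w).
exists (range (frame_map l D)).
  exact: frame_map_basic (frame_mulmx1 partialE) lieD.
exists (frame_map l D).
exact: frame_map_iso (frame_mulmx1 partialE) lieD.
Qed.

Lemma basic_realization_dexp (K : fieldType) (charK : [pchar K] =i pred0) n
   (L : lieVectType K) (l : n.-tuple L) (c : 'I_n -> 'I_n -> 'I_n -> K)
   (phi : {linear L -> 'W_n(K)}) (b : 'I_n -> 'I_n -> {mpoly K[n]}) :
  lie_nilpotent L ->
  basis_of {:L} l ->
  (forall i j : 'I_n, lie l`_i l`_j = \sum_(k < n) c i j k *: l`_k) ->
  (forall i j k : 'I_n, (k <= maxn i j)%N -> c i j k = 0) ->
  (forall x y, phi (lie x y) = lie (phi x) (phi y)) ->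
  (forall i : 'I_n, (partial K i : 'W^mod_n(K))
             = \sum_(j < n) b i j *: (phi l`_j : 'W^mod_n(K))) ->
  exists w : 'I_n -> {mpoly K[n]},
    let wbar : tensor {mpoly K[n]} L := \sum_(i < n) tens (w i) l`_i in
    (exists2 a : K, a != 0 & \det (jacobian w) = a%:MP_[n]) /\
    forall p : 'I_n, has_finite_sum
      (dexp_term (tensor_der (partial K p)) wbar)
      (\sum_(i < n) tens (b p i) l`_i).
Proof.
move=> nilL lb cE c0 phi_lie partialE0.
pose bbar p : tensor {mpoly K[n]} L := \sum_(i < n) tens (b p i) l`_i.
have coordE (i j k : 'I_n) : coord l k (lie l`_i l`_j) = c i j k.
  by rewrite cE coord_sum_free // (basis_free lb).
have tri (i j k : 'I_n) : (k <= maxn i j)%N -> coord l k (lie l`_i l`_j) = 0.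
  by move=> kij; rewrite coordE c0.
have [N N1 nilT] := @tensor_nilpotent_iter _ {mpoly K[n]} _ nilL.
have partialE p f : partial K p f = \sum_j tcoord l j (bbar p) * phi l`_j f.
  rewrite [partial K p]partialE0 derivation_mod_sumE.
  by apply: eq_bigr => j _; rewrite tcoord_sum.
have bflat : flat bbar.
  apply: (frame_flat lb partialE) => i j.
  rewrite -phi_lie {1}(coord_basis lb (memvf (lie _ _))) linear_sum.
  by apply: eq_bigr => k _; rewrite linearZ.
have [w wE] := flat_dexp charK lb N1 nilT tri bflat.
exists (fun i => tcoord l i w) => wbar.
have -> : wbar = w by rewrite [w in RHS](tensor_coordE lb).
split=> [|p].
  (* The matrix of the [bbar p] is invertible by [frame_mulmx1], and its determinant is that of the
     Jacobian up to sign. *)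
  apply: mpoly_unitP.
  have : \det (\matrix_(p, j) tcoord l j (bbar p)) \is a GRing.unit.
    by rewrite -unitmxE; exact: (proj1 (mulmx1_unit (frame_mulmx1 partialE))).
  have -> : \matrix_(p, j) tcoord l j (bbar p)
      = \matrix_(p, j) tcoord l j (dexp (partial K p) w N).
    by apply/matrixP=> p j; rewrite !mxE wE.
  by rewrite (det_dexp lb N1 tri) unitrM => /andP[].
exists N; split=> [i|]; first exact: dexp_term_eq0.
exact: wE.
Qed.

Theorem theorem1 (K : fieldType) (charK : [pchar K] =i pred0)
    (n : nat) (n_gt0 : (0 < n)%N) :
  (forall L : lieVectType K,
     lie_nilpotent L -> \dim {:L} = n ->
     exists2 Lbar : set 'W_n(K), basic_subalgebra Lbar &
       exists phi : {linear L -> 'W_n(K)}, lie_iso_onto phi Lbar)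
  /\
  (forall (L : lieVectType K) (l : n.-tuple L)
          (c : 'I_n -> 'I_n -> 'I_n -> K)
          (Lbar : set 'W_n(K)) (phi : {linear L -> 'W_n(K)})
          (b : 'I_n -> 'I_n -> {mpoly K[n]}),
     lie_nilpotent L ->
     basis_of {:L} l ->
     (forall i j : 'I_n, lie l`_i l`_j = \sum_(k < n) c i j k *: l`_k) ->
     (forall i j k : 'I_n, (k <= maxn i j)%N -> c i j k = 0) ->
     basic_subalgebra Lbar ->
     lie_iso_onto phi Lbar ->
     (forall i : 'I_n, (partial K i : 'W^mod_n(K))
                = \sum_(j < n) b i j *: (phi l`_j : 'W^mod_n(K))) ->
     let bbar (p : 'I_n) : tensor {mpoly K[n]} L :=
       \sum_(i < n) tens (b p i) l`_i in
     lie_nilpotent (tensor {mpoly K[n]} L) /\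
     exists w : 'I_n -> {mpoly K[n]},
       let wbar : tensor {mpoly K[n]} L := \sum_(i < n) tens (w i) l`_i in
       (exists2 a : K, a != 0 & \det (jacobian w) = a%:MP_[n]) /\
       forall p : 'I_n,
         has_finite_sum
           (fun i => (i`!%:R : K)^-1 *:
              iter i.-1 (lie wbar) (- tensor_der (partial K p) wbar))
           (bbar p)).
Proof.
split=> [L|L l c Lbar phi b nilL lb cE c0 _ [_ _ phi_lie] partialE bbar].
  exact: nilpotent_basic_realization.
split; first exact: tensor_nilpotent.
exact: (basic_realization_dexp charK nilL lb cE c0 phi_lie partialE).
Qed.
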